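(* Let $M$ be an atom-free MVS and let $(X,f)$ be an $M$-full and $M$-convex space. Then there exist a set $U_0\subset X\times X$ containing the diagonal $\Delta=\{(x,x):x\in X\}$ and a quasiuniformity $\mathcal{U}$ on $X$ compatible with the topology $\mathcal{T}_f$, such that $\mathcal{U}$ has a base $\mathcal{V}^{*}$ with $U_0\subsetneq U$ for all $U\in\mathcal{V}^{*}$ and $\bigcup\mathcal{V}^{*}=X\times X$, and such that conditions (Q1)--(Q4) below hold, where for all $x,y\in X$ the subset $U_{x,y}\ni(x,y)$ of $X\times X$ is defined by $$U_{x,y}=\bigcap\{U\in\mathcal{V}^{*}:(x,y)\in U\}\ \text{ if }(x,y)\notin U_0,\qquad U_{x,y}=U_0\ \text{ if }(x,y)\in U_0.$$ (Q1) $\mathcal{V}^{*}=\{U_{x,y}:(x,y)\in (X\times X)\setminus U_0\}$. (Q2) Let $\mathcal{V}=\mathcal{V}^{*}\cup\{U_0\}$ and for $U,V\in\mathcal{V}$ let $U+V$ be the intersection of all sets $W\in\mathcal{V}$ such that $V\circ U\subset W$. Then $\mathcal{V}$ is closed under the operation $+$, and $(\mathcal{V},+)$ is an MVS with neutral element $U_0$. (Q3) For the relation $\unlhd$ on $\mathcal{V}$ induced by $+$ (that is, $U\unlhd V$ iff $U+W=V$ for some $W\in\mathcal{V}$), and all $U,V\in\mathcal{V}$: $U\unlhd V$ if and only if $U\subset V$. (Q4) The MVS $(\mathcal{V},+)$ is atom-free.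
   Context: A metric value set (MVS) is a set $M$ with at least two elements and a binary operation $+$ such that: (M1) $+$ is associative; (M2) $+$ has a (two-sided) neutral element $e$, and we write $M^{*}=M\setminus\{e\}$; (M3) if $m_1+m_2=e$ then $m_1=m_2=e$; (M4) for all $m_1,m_2\in M^{*}$ there are $m_3\in M^{*}$ and $m_4,m_5\in M$ with $m_1=m_3+m_4$ and $m_2=m_3+m_5$. For $m_1,m_2\in M$ write $m_1\unlhd m_2$ if $m_1+m_3=m_2$ for some $m_3\in M$, and $m_1\lhd m_2$ if $m_1+m_3=m_2$ for some $m_3\in M^{*}$ (so $m\lhd m$ is possible). $M$ is atom-free if $+$ is commutative and for every $m\in M^{*}$ there is $n\in M^{*}$ with $n\lhd m$. A quasimetric function is a map $f\colon X\times X\to M$ with $f(x,x)=e$ for all $x\in X$ and $f(x,z)\unlhd f(x,y)+f(y,z)$ for all $x,y,z\in X$ (no symmetry is required). It induces the topology $\mathcal{T}_f$ on $X$ in which, for every $x\in X$, the balls $B_f(x,m)=\{y\in X: f(x,y)\lhd m\}$, $m\in M^{*}$, form an open neighbourhood base at $x$. The pair $(X,f)$ is called an $M$-space. It is $M$-full if $f$ is surjective onto $M$. It is $M$-convex if: whenever $m_1,m_2,m_3\in M$ with $m_2+m_3=m_1$ and $x,y\in X$ with $f(x,y)=m_1$, there is $z\in X$ with $f(x,z)=m_2$ and $f(z,y)=m_3$. For $A,B\subset X\times X$, $A\circ B$ is the set of $(x,z)$ for which there is $y\in X$ with $(x,y)\in B$ and $(y,z)\in A$. A quasiuniformity on $X$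 is a non-empty family $\mathcal{U}$ of subsets of $X\times X$, each containing the diagonal, closed under supersets in $X\times X$ and under pairwise intersections, and such that for each $U\in\mathcal{U}$ there is $V\in\mathcal{U}$ with $V\circ V\subset U$. A base of $\mathcal{U}$ is a subfamily $\mathcal{B}\subset\mathcal{U}$ such that every $U\in\mathcal{U}$ contains some member of $\mathcal{B}$. The topology induced by $\mathcal{U}$ (equivalently by any base $\mathcal{B}$) is the one for which, for each $x\in X$, the sets $U[x]=\{y\in X:(x,y)\in U\}$, $U\in\mathcal{B}$, form a (not necessarily open) neighbourhood base at $x$. $\mathcal{U}$ is compatible with a topology $\mathcal{T}$ if the topology it induces is $\mathcal{T}$. *)

(* Defs.v *)
From HB Require Import structures.
From mathcomp Require Import all_boot.
From mathcomp Require Import boolp classical_sets filter topology.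

Set Implicit Arguments.
Unset Strict Implicit.
Unset Printing Implicit Defensive.

Local Open Scope classical_set_scope.
Local Open Scope relation_scope.

(* The carrier of a metric value set is a subset A of a type T (the whole type
   for the value set of a space, a family of relations for the MVS built from a
   quasiuniformity); all axioms are relativized to A, and [A `\ e] is
   A minus its neutral element. *)
Record is_mvs (T : Type) (A : set T) (op : T -> T -> T) (e : T) : Prop := {
  mvs_closed : forall a b, A a -> A b -> A (op a b);
  mvs_two : exists a b, [/\ A a, A b & a <> b];
  mvs_assoc : forall a b c, A a -> A b -> A c ->
    op a (op b c) = op (op a b) c;
  mvs_neutral_in : A e;
  mvs_neutral : forall a, A a -> op e a = a /\ op a e = a;
  mvs_zerosum : forall a b, A a -> A b -> op a b = e -> a = e /\ b = e;
  mvs_refine : forall a b, (A `\ e) a -> (A `\ e) b ->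
    exists c d d', [/\ (A `\ e) c, A d, A d', a = op c d & b = op c d'] }.

Definition mvs_le (T : Type) (A : set T) (op : T -> T -> T) (a b : T) : Prop :=
  exists2 c, A c & op a c = b.

Definition mvs_lt (T : Type) (A : set T) (op : T -> T -> T) (e a b : T) : Prop :=
  exists2 c, (A `\ e) c & op a c = b.

Definition atom_free (T : Type) (A : set T) (op : T -> T -> T) (e : T) : Prop :=
  (forall a b, A a -> A b -> op a b = op b a) /\
  (forall m, (A `\ e) m -> exists2 n, (A `\ e) n & mvs_lt A op e n m).

Definition quasimetric (M : Type) (add : M -> M -> M) (e : M)
    (X : Type) (f : X -> X -> M) : Prop :=
  (forall x, f x x = e) /\
  (forall x y z, mvs_le setT add (f x z) (add (f x y) (f y z))).

Definition mfull (M X : Type) (f : X -> X -> M) : Prop :=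
  forall m, exists x y, f x y = m.

Definition mconvex (M : Type) (add : M -> M -> M)
    (X : Type) (f : X -> X -> M) : Prop :=
  forall m1 m2 m3, add m2 m3 = m1 -> forall x y, f x y = m1 ->
    exists z, f x z = m2 /\ f z y = m3.

Definition qball (M : Type) (add : M -> M -> M) (e : M)
    (X : Type) (f : X -> X -> M) (x : X) (m : M) : set X :=
  [set y | mvs_lt setT add e (f x y) m].

(* [qspace hM hf] is X equipped with the topology induced by f: the
   neighbourhoods of x are the sets containing some ball B(x, m) with m <> e
   (balls are open by [open_qball]). *)
Definition qspace (M : Type) (add : M -> M -> M) (e : M)
    (hM : is_mvs setT add e) (X : Type) (f : X -> X -> M)
    (hf : quasimetric add e f) : Type := X.

Section qspace_topology.
Context (M : Type) (add : M -> M -> M) (e : M) (hM : is_mvs setT add e).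
Context (X : Type) (f : X -> X -> M) (hf : quasimetric add e f).

Local Notation Y := (qspace hM hf).
Local Notation B := (qball add e f).

HB.instance Definition _ := gen_eqMixin Y.
HB.instance Definition _ := gen_choiceMixin Y.
HB.instance Definition _ :=
  hasNbhs.Build Y (fun x => filter_from ([set: M] `\ e) (B x)).

Lemma nbhs_qspaceE (x : Y) : nbhs x = filter_from ([set: M] `\ e) (B x).
Proof. by []. Qed.

Lemma qball_center x m : m <> e -> B x m x.
Proof.
move=> me; exists m => //.
by rewrite (proj1 hf); case: (mvs_neutral hM (a := m)).
Qed.

Lemma qball_sub x y m : B x m y ->
  exists2 n, ([set: M] `\ e) n & B y n `<=` B x m.
Proof.
move=> [n [_ ne] nm]; exists n => // z [q [_ qe] qn].
have [p _ pE] := proj2 hf x y z.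
exists (add p q).
  by split=> // pq; have [_ /qe] := mvs_zerosum hM I I pq.
by rewrite (mvs_assoc hM) // pE -(mvs_assoc hM) // qn.
Qed.

Lemma nbhs_qspace_filter (x : Y) : ProperFilter (nbhs x).
Proof.
rewrite nbhs_qspaceE; apply: filter_from_proper; last first.
  by move=> m [_ me]; exists x; exact: qball_center.
apply: filter_from_filter.
  have [a [b [_ _ ab]]] := mvs_two hM.
  have [ae|ae] := pselect (a = e); last by exists a.
  by exists b; split=> // be; apply: ab; rewrite ae be.
move=> m n hm hn.
have [c [d [d' [hc _ _ mE nE]]]] := mvs_refine hM hm hn.
exists c => // y [q [_ qe] qc]; split.
- exists (add q d).
    by split=> // qd; have [/qe] := mvs_zerosum hM I I qd.
  by rewrite (mvs_assoc hM) // qc mE.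
- exists (add q d').
    by split=> // qd; have [/qe] := mvs_zerosum hM I I qd.
  by rewrite (mvs_assoc hM) // qc nE.
Qed.

Lemma nbhs_qspace_singleton (x : Y) (A : set Y) : nbhs x A -> A x.
Proof. by move=> [m [_ me] mA]; apply: mA; exact: qball_center. Qed.

Lemma nbhs_qspace_nbhs (x : Y) (A : set Y) : nbhs x A -> nbhs x (nbhs^~ A).
Proof.
move=> [m hm mA]; exists m => // y /qball_sub[n hn nB].
by exists n => //; exact: subset_trans mA.
Qed.

HB.instance Definition _ := Nbhs_isNbhsTopological.Build Y
  nbhs_qspace_filter nbhs_qspace_singleton nbhs_qspace_nbhs.

Lemma open_qball (x : Y) m : open (B x m : set Y).
Proof. by rewrite openE => y /qball_sub[n hn nB]; exists n. Qed.

End qspace_topology.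

(* The library notation [B \; A] of relation_scope is the set of (x, z) such
   that A (x, y) and B (y, z) for some y. *)
Record is_quasiuniformity (X : Type) (UU : set (set (X * X))) : Prop := {
  qunif_nonempty : UU !=set0;
  qunif_diagonal : forall U, UU U -> diagonal `<=` U;
  qunif_superset : forall U V, UU U -> U `<=` V -> UU V;
  qunif_setI : forall U V, UU U -> UU V -> UU (U `&` V);
  qunif_comp : forall U, UU U -> exists2 V, UU V & V \; V `<=` U }.

Definition is_qunif_base (X : Type) (UU BB : set (set (X * X))) : Prop :=
  BB `<=` UU /\ forall U, UU U -> exists2 B, BB B & B `<=` U.

(* The sets U[x], U in UU, form a neighbourhood base at every x. *)
Definition qunif_compatible (X : topologicalType) (UU : set (set (X * X))) :
    Prop :=
  forall x : X, nbhs x = filter_from UU (fun U => xsection U x).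

Definition rel_at (X : Type) (U0 : set (X * X)) (VV : set (set (X * X)))
    (p : X * X) : set (X * X) :=
  if p \in U0 then U0 else \bigcap_(U in [set U | VV U /\ U p]) U.

Definition rel_add (X : Type) (VV : set (set (X * X))) (U V : set (X * X)) :
    set (X * X) :=
  \bigcap_(W in [set W | VV W /\ V \; U `<=` W]) W.

(* Main.v *)
Require Import Defs.
From mathcomp Require Import all_boot.
From mathcomp Require Import boolp classical_sets filter topology.

Local Open Scope classical_set_scope.

(** The witnesses are the closed balls, uniform in the centre:
    [U_m] is the set of pairs [(x, y)] with [f x y <= m], where [<=] is the
    divisibility preorder [mvs_le] of [M]; [U0] is [U_e], the base consists of
    the [U_m] with [m <> e], and the quasiuniformity is what they generate.

    Everything follows from the fact that [m |-> U_m] carries the structure of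
    [M] to that of [V].  Since [f] is onto, [U_m] is contained in [U_n] exactly
    when [m <= n] ([entourage_subset]).  The triangle inequality puts the
    composite of [U_m] and [U_n] inside [U_(m + n)].  The composite need not
    fill [U_(m + n)], because [M] need not have the Riesz decomposition
    property, but it contains some pair at distance exactly [m + n]: take any
    pair at that distance and split it by convexity.  Hence [U_(m + n)] is the
    least [U_k] above the composite, which is what [rel_add] computes
    ([rel_add_entourage]).  So [m |-> U_m] is an additive surjection whose
    fibre over [U0] is [{e}]; it merely identifies the values that are below
    each other ([<=] need not be antisymmetric), and the axioms of an
    atom-free metric value set pass to such an image.

    Finally, atom-freeness splits each [m <> e] as [n + c] with both summands
    nontrivial, and a common nontrivial lower bound [d] of [n] and [c]
    satisfies [d + d <= m].  This is the composition axiom of a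
    quasiuniformity. *)

(** * Divisibility in a commutative metric value set *)

Section ValueSet.
Local Set Implicit Arguments.
Local Unset Strict Implicit.
Context {M : Type} {add : M -> M -> M} {e : M}.
Context (hM : is_mvs [set: M] add e).
Context (hatom : atom_free [set: M] add e).

Local Notation "a <=m b" := (mvs_le [set: M] add a b) (at level 70).

Let addA a b c : add a (add b c) = add (add a b) c.
Proof. exact: (mvs_assoc hM). Qed.

Let addC a b : add a b = add b a.
Proof. by apply: (proj1 hatom). Qed.

Lemma value_le_addr a b : a <=m add a b.
Proof. by exists b. Qed.

Lemma value_le_refl a : a <=m a.
Proof. by exists e => //; case: (mvs_neutral hM (a := a)). Qed.

Lemma value_le_trans b a c : a <=m b -> b <=m c -> a <=m c.
Proof.
move=> [p _ <-] [q _ <-]; rewrite -addA; exact: value_le_addr.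
Qed.

Lemma value_le_add a b c d : a <=m b -> c <=m d -> add a c <=m add b d.
Proof.
move=> [p _ <-] [q _ <-]; exists (add p q) => //.
by rewrite -!addA; congr add; rewrite !addA (addC c p).
Qed.

Lemma value_ge_neutral a : e <=m a.
Proof. by exists a => //; case: (mvs_neutral hM (a := a)). Qed.

Lemma value_le_neutral a : a <=m e -> a = e.
Proof. by move=> [c _ /(mvs_zerosum hM I I)[]]. Qed.

Lemma exists_nonneutral : exists m, m <> e.
Proof.
have [a [b [_ _ ab]]] := mvs_two hM.
have [ae|] := pselect (a = e); last by exists a.
by exists b => be; apply: ab; rewrite ae be.
Qed.

Lemma common_lower_bound a b : a <> e -> b <> e ->
  exists d, [/\ d <> e, d <=m a & d <=m b].
Proof.
move=> ae be.
have [d [a' [b' [[_ de] _ _ -> ->]]]] := mvs_refine hM (conj I ae) (conj I be).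
by exists d; split=> //; exact: value_le_addr.
Qed.

Lemma exists_half m : m <> e -> exists2 d, d <> e & add d d <=m m.
Proof.
move=> me; have [n [_ ne] [c [_ ce] <-]] := proj2 hatom m (conj I me).
have [d [de dn dc]] := common_lower_bound ne ce.
by exists d => //; exact: value_le_add.
Qed.

(** * The entourages of a full convex space *)

Context {X : Type} {f : X -> X -> M}.
Context (hf : quasimetric add e f) (hfull : mfull f).
Context (hconvex : mconvex add f).

Definition entourage_le (m : M) : set (X * X) := [set p | f p.1 p.2 <=m m].

Local Notation U := entourage_le.

Definition proper_entourages : set (set (X * X)) :=
  [set U m | m in [set~ e]].

Definition all_entourages : set (set (X * X)) :=
  proper_entourages `|` [set U e].

(** A pair at distance exactly [m] tests membership of [m] itself. *)
Lemma entourage_subset m n : U m `<=` U n <-> m <=m n.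
Proof.
split=> [mn|mn p pm]; last exact: value_le_trans mn.
have [x [y fxy]] := hfull m.
by move: (mn (x, y)); rewrite /entourage_le /= fxy; apply; exact: value_le_refl.
Qed.

Lemma entourage_neutral m : U m = U e -> m = e.
Proof.
by move=> mE; apply/value_le_neutral/entourage_subset; rewrite mE.
Qed.

Lemma entourage_neutralE p : U e p <-> f p.1 p.2 = e.
Proof.
split=> [/value_le_neutral//|pe]; rewrite /entourage_le /= pe.
exact: value_le_refl.
Qed.

Lemma all_entouragesE : all_entourages = range U.
Proof.
apply/seteqP; split=> [_ [[m _ <-]|->]|_ [m _ <-]].
- by exists m.
- by exists e.
- by have [->|me] := pselect (m = e); [right|left; exists m].
Qed.

Lemma all_entourages_entourage m : all_entourages (U m).
Proof. by rewrite all_entouragesE; exists m. Qed.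

(** The sum is computed on a single pair: convexity splits a pair at distance
    [m + n] into steps [m] and [n], so each [U k] above the composite contains
    that pair, that is, [m + n <= k]. *)
Lemma rel_add_entourage m n : rel_add all_entourages (U m) (U n) = U (add m n).
Proof.
apply/seteqP; split=> [p|p pmn W [+ compW]].
  apply; split; first exact: all_entourages_entourage.
  move=> [x z] [y /= xy yz].
  apply: value_le_trans (proj2 hf x y z) _; exact: value_le_add.
rewrite all_entouragesE => -[k _ kW]; move: compW; rewrite -{}kW => compk.
apply: (iffRL (entourage_subset _ _) _) pmn.
have [x [z fxz]] := hfull (add m n).
have [y [fxy fyz]] : exists y, f x y = m /\ f y z = n by exact: hconvex fxz.
have : U k (x, z).
  by apply: compk; exists y; rewrite /entourage_le /= ?fxy ?fyz;
    exact: value_le_refl.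
by rewrite /entourage_le /= fxz.
Qed.

(** * The value set of entourages *)

Lemma entourages_nonneutral W :
  (all_entourages `\ U e) W <-> exists2 m, m <> e & W = U m.
Proof.
split=> [[[[m me <-]|//] _]|[m me ->]]; first by exists m.
by split; [exact: all_entourages_entourage|move/entourage_neutral].
Qed.

Lemma is_mvs_entourages :
  is_mvs all_entourages (rel_add all_entourages) (U e).
Proof.
have inV := all_entourages_entourage.
split.
- move=> A B; rewrite {1 2}all_entouragesE => -[m _ <-] [n _ <-].
  by rewrite rel_add_entourage.
- have [m me] := exists_nonneutral.
  by exists (U m), (U e); split=> // /entourage_neutral.
- move=> A B C; rewrite {1 2 3}all_entouragesE.
  by move=> -[m _ <-] [n _ <-] [k _ <-]; rewrite !rel_add_entourage addA.
- exact: inV.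
- move=> A; rewrite {1}all_entouragesE => -[m _ <-].
  by rewrite !rel_add_entourage; have [//|-> ->] := mvs_neutral hM (a := m).
- move=> A B; rewrite {1 2}all_entouragesE => -[m _ <-] [n _ <-].
  rewrite rel_add_entourage => /entourage_neutral.
  by move=> /(mvs_zerosum hM I I)[-> ->].
- move=> A B /entourages_nonneutral[m me ->] /entourages_nonneutral[n ne ->].
  have [d [de [m' _ <-] [n' _ <-]]] := common_lower_bound me ne.
  exists (U d), (U m'), (U n'); rewrite !rel_add_entourage; split=> //.
  by apply/entourages_nonneutral; exists d.
Qed.

Lemma entourages_leE A B : all_entourages A -> all_entourages B ->
  mvs_le all_entourages (rel_add all_entourages) A B <-> A `<=` B.
Proof.
rewrite {1 2}all_entouragesE => -[m _ <-] [n _ <-]; split.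
  move=> [C]; rewrite all_entouragesE => -[k _ <-].
  rewrite -all_entouragesE rel_add_entourage => <-.
  exact/entourage_subset/value_le_addr.
move=> /entourage_subset[k _ <-].
by exists (U k); [exact: all_entourages_entourage|exact: rel_add_entourage].
Qed.

Lemma atom_free_entourages :
  atom_free all_entourages (rel_add all_entourages) (U e).
Proof.
split=> [A B|W /entourages_nonneutral[m me ->]].
  rewrite {1 2}all_entouragesE => -[m _ <-] [n _ <-].
  by rewrite !rel_add_entourage addC.
have [n [_ ne] [c [_ ce] <-]] := proj2 hatom m (conj I me).
exists (U n); first by apply/entourages_nonneutral; exists n.
exists (U c); last exact: rel_add_entourage.
by apply/entourages_nonneutral; exists c.
Qed.

(** * The quasiuniformity of entourages *)

Definition entourage_qunif : set (set (X * X)) :=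
  filter_from [set~ e] U.

Lemma is_quasiuniformity_entourages : is_quasiuniformity entourage_qunif.
Proof.
split.
- by have [m me] := exists_nonneutral; exists (U m), m.
- move=> W [m _ mW] p diag_p; apply: mW.
  rewrite /entourage_le /= -diag_p (proj1 hf); exact: value_ge_neutral.
- by move=> V W [m me mV] VW; exists m => //; exact: subset_trans VW.
- move=> V W [m me mV] [n ne nW].
  have [d [de dm dn]] := common_lower_bound me ne.
  exists d => // p pd; split; [apply: mV|apply: nW];
    exact: value_le_trans pd _.
- move=> W [m me mW]; have [d de ddm] := exists_half me.
  exists (U d); first by exists d.
  move=> [x z] [y /= xy yz]; apply: mW.
  apply: value_le_trans (proj2 hf x y z) _; apply: value_le_trans ddm.
  exact: value_le_add.
Qed.

Lemma is_qunif_base_entourages :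
  is_qunif_base entourage_qunif proper_entourages.
Proof.
split=> [_ [m me <-]|W [m me mW]]; first by exists m.
by exists (U m) => //; exists m.
Qed.

(** Balls and entourages are defined by [mvs_lt] and [mvs_le]; the two
    neighbourhood bases interleave since each [m <> e] has some [n <> e]
    strictly below it. *)
Lemma qunif_compatible_entourages :
  @qunif_compatible (qspace hM hf) entourage_qunif.
Proof.
move=> x; rewrite nbhs_qspaceE; apply/seteqP; split=> A.
  move=> [m [_ me] mA].
  have [n [_ ne] [c [_ ce] ncm]] := proj2 hatom m (conj I me).
  exists (U n); first by exists n.
  move=> y /xsectionP[d _ /= dn]; apply: mA; exists (add d c).
    by split=> // /(mvs_zerosum hM I I)[_ /ce].
  by rewrite addA dn.
move=> [W [m me mW] WA]; exists m => // y [c _ cm].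
by apply/WA/xsectionP/mW; exists c.
Qed.

Lemma proper_entourages_proper W : proper_entourages W -> U e `<` W.
Proof.
move=> [m me <-]; split; last first.
  by move=> /entourage_subset/value_le_neutral.
exact/entourage_subset/value_ge_neutral.
Qed.

Lemma bigcup_proper_entourages :
  \bigcup_(W in proper_entourages) W = [set: X * X].
Proof.
apply/seteqP; split=> // p _.
have [pe|pe] := pselect (f p.1 p.2 = e); last first.
  by exists (U (f p.1 p.2)); [exists (f p.1 p.2)|exact: value_le_refl].
have [m me] := exists_nonneutral.
exists (U m); first by exists m.
rewrite /entourage_le /= pe; exact: value_ge_neutral.
Qed.

Lemma rel_at_entourage p : ~ U e p ->
  rel_at (U e) proper_entourages p = U (f p.1 p.2).
Proof.
move=> pe; rewrite /rel_at memNset //.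
apply/seteqP; split=> [q|q qp _ [[m _ <-] pm]]; last exact: value_le_trans pm.
apply; split; last exact: value_le_refl.
by exists (f p.1 p.2) => // /entourage_neutralE.
Qed.

Lemma proper_entouragesE :
  proper_entourages = [set rel_at (U e) proper_entourages p | p in ~` U e].
Proof.
apply/seteqP; split=> [_ [m me <-]|_ [p pe <-]].
  have [x [y fxy]] := hfull m.
  have xye : ~ U e (x, y) by move=> /entourage_neutralE /=; rewrite fxy.
  by exists (x, y) => //; rewrite rel_at_entourage //= fxy.
rewrite rel_at_entourage //.
by exists (f p.1 p.2) => // /entourage_neutralE.
Qed.

End ValueSet.

Theorem theorem2p13 (M : Type) (add : M -> M -> M) (e : M)
    (hM : is_mvs [set: M] add e) (hatom : atom_free [set: M] add e)
    (X : Type) (f : X -> X -> M) (hf : quasimetric add e f)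
    (hfull : mfull f) (hconvex : mconvex add f) :
  exists (U0 : set (X * X)) (UU Vstar : set (set (X * X))),
    let V := Vstar `|` [set U0] in
    let addV := rel_add V in
    diagonal `<=` U0 /\
    is_quasiuniformity UU /\
    @qunif_compatible (qspace hM hf) UU /\
    is_qunif_base UU Vstar /\
    (forall U, Vstar U -> U0 `<` U) /\
    \bigcup_(U in Vstar) U = [set: X * X] /\
    Vstar = [set rel_at U0 Vstar p | p in ~` U0] /\
    is_mvs V addV U0 /\
    (forall A B, V A -> V B -> (mvs_le V addV A B <-> A `<=` B)) /\
    atom_free V addV U0.
Proof.
exists (@entourage_le M add X f e), (@entourage_qunif M add e X f),
  (@proper_entourages M add e X f).
split.
  move=> p diag_p; apply/(entourage_neutralE hM).
  by rewrite -diag_p (proj1 hf).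
split; first exact: is_quasiuniformity_entourages.
split; first exact: qunif_compatible_entourages.
split; first exact: is_qunif_base_entourages.
split; first exact: (proper_entourages_proper hM hfull).
split; first exact: bigcup_proper_entourages.
split; first exact: (proper_entouragesE hM hfull).
split; first exact: is_mvs_entourages.
split; first exact: entourages_leE.
exact: atom_free_entourages.
Qed.
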